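(* Let $K\subseteq F$ be a field extension. Then the lattice of ideals of the power series ring $R=K+XF[[X]]$ is lattice isomorphic to $1\oplus(\mathbb{N}^\partial\circ \mathrm{AG}(F,K))\oplus 1$, where $1$ is the one element lattice.
   Context: $K+XF[[X]]$ is the subring of $F[[X]]$ of power series whose constant term lies in $K$. Its ideals (including $\langle 0\rangle$ and $R$) are ordered by inclusion. $\mathrm{AG}(F,K)$ is the poset, under inclusion, of all nonzero $K$-subspaces of $F$ regarded as a vector space over $K$. For a poset $P$, the dual poset $P^\partial$ is the set $P$ with the order $a\le_\partial b$ iff $b\le a$; $\mathbb{N}$ has its usual order. For posets $A,B$, $A\circ B$ denotes the lexicographic product: the set $A\times B$ with $(a_1,b_1)\le(a_2,b_2)$ iff $a_1<a_2$ in $A$, or $a_1=a_2$ and $b_1\le b_2$. Thus in $\mathbb{N}^\partial\circ\mathrm{AG}(F,K)$, $(n,W)\le(m,W')$ iff $n>m$ in the usual order, or $n=m$ and $W\subseteq W'$. Here $1\oplus P\oplus 1$ denotes the ordinal sum, i.e. the poset $P$ with a new least element adjoined (the first $1$, representing the ideal $\langle 0\rangle$) and a new greatest element adjoined (the last $1$, representing the entire ring). *)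

(* Defs.v *)
From HB Require Import structures.
From mathcomp Require Import all_boot all_order all_algebra.
From mathcomp Require Import boolp classical_sets.

Set Implicit Arguments.
Unset Strict Implicit.
Unset Printing Implicit Defensive.

Import Order.TTheory GRing.Theory.
Local Open Scope classical_set_scope.
Local Open Scope ring_scope.

Record fps (F : fieldType) := Fps { fps_coef :> nat -> F }.

Section FpsRing.
Variable F : fieldType.
Implicit Types f g h : fps F.

HB.instance Definition _ := [isNew for @fps_coef F].
HB.instance Definition _ := [Choice of fps F by <:].

Lemma fpsP f g : f =1 g -> f = g.
Proof. by case: f g => f [g] /= fg; congr Fps; apply/funext. Qed.

Definition fps_zero : fps F := Fps (fun=> 0).
Definition fps_opp f := Fps (fun n => - f n).
Definition fps_add f g := Fps (fun n => f n + g n).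
Definition fps_one : fps F := Fps (fun n => (n == 0%N)%:R).
Definition fps_mul f g := Fps (fun n => \sum_(i < n.+1) f i * g (n - i)%N).

Fact fps_addA : associative fps_add.
Proof. by move=> f g h; apply: fpsP => n /=; rewrite addrA. Qed.
Fact fps_addC : commutative fps_add.
Proof. by move=> f g; apply: fpsP => n /=; rewrite addrC. Qed.
Fact fps_add0 : left_id fps_zero fps_add.
Proof. by move=> f; apply: fpsP => n /=; rewrite add0r. Qed.
Fact fps_addN : left_inverse fps_zero fps_opp fps_add.
Proof. by move=> f; apply: fpsP => n /=; rewrite addNr. Qed.

HB.instance Definition _ :=
  GRing.isZmodule.Build (fps F) fps_addA fps_addC fps_add0 fps_addN.

Let tr N f : {poly F} := \poly_(i < N.+1) f i.

Let trE N f i : (i <= N)%N -> (tr N f)`_i = f i.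
Proof. by move=> iN; rewrite coef_poly ltnS iN. Qed.

Let mul_tr N f g n : (n <= N)%N -> fps_mul f g n = (tr N f * tr N g)`_n.
Proof.
move=> nN; rewrite coefM; apply: eq_bigr => i _.
by rewrite !trE // ?(leq_trans (leq_subr _ _)) // (leq_trans _ nN) // -ltnS.
Qed.

Fact fps_mulA : associative fps_mul.
Proof.
move=> f g h; apply: fpsP => n.
have -> : fps_mul f (fps_mul g h) n = (tr n f * (tr n g * tr n h))`_n.
  rewrite coefM; apply: eq_bigr => i _.
  by rewrite trE -1?ltnS // (@mul_tr n) ?leq_subr.
rewrite mulrA coefM; apply: eq_bigr => i _.
by rewrite trE ?leq_subr // (@mul_tr n) // -ltnS.
Qed.

Fact fps_mulC : commutative fps_mul.
Proof.
by move=> f g; apply: fpsP => n; rewrite !(@mul_tr n) // mulrC.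
Qed.

Fact fps_mul1 : left_id fps_one fps_mul.
Proof.
move=> f; apply: fpsP => n /=.
rewrite big_ord_recl /= mul1r subn0 big1 ?addr0 // => i _.
by rewrite mul0r.
Qed.

Fact fps_mulD : left_distributive fps_mul fps_add.
Proof.
move=> f g h; apply: fpsP => n /=; rewrite -big_split /=.
by apply: eq_bigr => i _; rewrite mulrDl.
Qed.

Fact fps_one_neq0 : fps_one != 0.
Proof.
by apply/eqP => /(congr1 (fun f : fps F => f 0%N)) /eqP; rewrite /= oner_eq0.
Qed.

HB.instance Definition _ := GRing.Zmodule_isComNzRing.Build (fps F)
  fps_mulA fps_mulC fps_mul1 fps_mulD fps_one_neq0.

End FpsRing.

(* A subfield of F is given as a predicate K : divringClosed F, i.e. one closed under
   the field operations. *)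

Section ConstIn.
Variables (F : fieldType) (K : divringClosed F).

Definition const_in : {pred fps F} := [pred f : fps F | f 0%N \in K].

Fact const_in_subring : subring_closed const_in.
Proof.
split=> [|f g|f g]; rewrite !inE /=; first exact: rpred1.
  exact: rpredB.
by rewrite big_ord1; apply: rpredM.
Qed.

HB.instance Definition _ := GRing.isSubringClosed.Build (fps F) const_in
  const_in_subring.

Record const_fps :=
  ConstFps { const_fps_val :> fps F; _ : const_fps_val \in const_in }.

HB.instance Definition _ := [isSub for const_fps_val].
HB.instance Definition _ := [Choice of const_fps by <:].
HB.instance Definition _ := [SubChoice_isSubComNzRing of const_fps by <:].

End ConstIn.

Section Ideals.
Variable R : comNzRingType.

Definition is_ideal (I : set R) :=
  [/\ I 0, forall x y, I x -> I y -> I (x + y) & forall a x, I x -> I (a * x)].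

(* Unlike idealr_closed, this does not exclude the unit ideal. *)
Record ideal := Ideal { ideal_set :> set R; _ : `[< is_ideal ideal_set >] }.

HB.instance Definition _ := [isSub for ideal_set].
HB.instance Definition _ := [Choice of ideal by <:].
HB.instance Definition _ :=
  Order.SubChoice_isSubPOrder.Build _ _ _ set_display ideal.

Lemma idealP (I : ideal) : is_ideal I.
Proof. by case: I => I /= /asboolP. Qed.

Lemma ideal_leP (I J : ideal) : reflect (I `<=` J) (I <= J)%O.
Proof. by rewrite -Order.le_val; apply: subsetPset. Qed.

Fact idealI_subproof (I J : ideal) : `[< is_ideal (I `&` J) >].
Proof.
apply/asboolP; have [I0 ID IM] := idealP I; have [J0 JD JM] := idealP J.
by split=> // [x y [? ?] [? ?]|a x [? ?]]; split; auto.
Qed.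

Definition idealI (I J : ideal) := Ideal (idealI_subproof I J).

Fact idealD_subproof (I J : ideal) :
  `[< is_ideal [set x + y | x in I & y in J] >].
Proof.
apply/asboolP; have [I0 ID IM] := idealP I; have [J0 JD JM] := idealP J.
split=> [|_ _ [a Ia [b Jb <-]] [c Ic [d Jd <-]]|c _ [a Ia [b Jb <-]]].
- by exists 0 => //; exists 0 => //; rewrite addr0.
- by exists (a + c); [exact: ID|exists (b + d); [exact: JD|rewrite addrACA]].
- by exists (c * a); [exact: IM|exists (c * b); [exact: JM|rewrite mulrDr]].
Qed.

Definition idealD (I J : ideal) := Ideal (idealD_subproof I J).

Fact idealI_meet (I J L : ideal) : (I <= idealI J L)%O = (I <= J)%O && (I <= L)%O.
Proof.
apply/ideal_leP/andP => [IJL|[/ideal_leP IJ /ideal_leP IL] x Ix].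
  by split; apply/ideal_leP => x /IJL[].
by split; auto.
Qed.

Fact idealD_join (I J L : ideal) : (idealD I J <= L)%O = (I <= L)%O && (J <= L)%O.
Proof.
have [I0 _ _] := idealP I; have [J0 _ _] := idealP J.
have [_ LD _] := idealP L.
apply/ideal_leP/andP => [IJL|[/ideal_leP IL /ideal_leP JL] _ [x Ix [y Jy <-]]].
  split; apply/ideal_leP => x xI; apply: IJL.
    by exists x => //; exists 0 => //; rewrite addr0.
  by exists 0 => //; exists x => //; rewrite add0r.
by apply: LD; auto.
Qed.

HB.instance Definition _ :=
  Order.POrder_MeetJoin_isLattice.Build set_display ideal
    idealI_meet idealD_join.

End Ideals.

Section AG.
Variables (F : fieldType) (K : divringClosed F).

Definition is_subspace (W : set F) :=
  [/\ W 0, forall x y, W x -> W y -> W (x + y)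
    & forall k x, k \in K -> W x -> W (k * x)].

Record AG := MkAG {
  AG_set :> set F;
  _ : `[< is_subspace AG_set >] && (AG_set != [set 0])
}.

HB.instance Definition _ := [isSub for AG_set].
HB.instance Definition _ := [Choice of AG by <:].
HB.instance Definition _ :=
  Order.SubChoice_isSubPOrder.Build _ _ _ set_display AG.

Lemma AG_subspace (W : AG) : is_subspace W.
Proof. by case: W => W /= /andP[/asboolP]. Qed.

Lemma AG_neq0 (W : AG) : (W : set F) != [set 0].
Proof. by case: W => W /= /andP[]. Qed.

Lemma AG_leP (W V : AG) : reflect (W `<=` V) (W <= V)%O.
Proof. by rewrite -Order.le_val; apply: subsetPset. Qed.

Fact AG_full_subproof :
  `[< is_subspace [set: F] >] && ([set: F] != [set 0]).
Proof.
apply/andP; split; first exact/asboolP.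
apply/eqP => T0; have : [set: F] 1 by [].
by rewrite T0 => /eqP; rewrite oner_eq0.
Qed.

Definition AG_full : AG := MkAG AG_full_subproof.

Fact AG_add_subproof (W V : AG) (S := [set x + y | x in W & y in V]) :
  `[< is_subspace S >] && (S != [set 0]).
Proof.
have [W0 WD WM] := AG_subspace W; have [V0 VD VM] := AG_subspace V.
apply/andP; split.
  apply/asboolP.
  split=> [|_ _ [a Wa [b Vb <-]] [c Wc [d Vd <-]]|k _ kK [a Wa [b Vb <-]]].
  - by exists 0 => //; exists 0 => //; rewrite addr0.
  - by exists (a + c); [exact: WD|exists (b + d); [exact: VD|rewrite addrACA]].
  - by exists (k * a); [exact: WM|exists (k * b); [exact: VM|rewrite mulrDr]].
apply: contraNN (AG_neq0 W) => /eqP S0; apply/eqP/seteqP; split=> [x Wx|_ -> //].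
by rewrite -S0; exists x => //; exists 0 => //; rewrite addr0.
Qed.

Definition AG_add (W V : AG) : AG := MkAG (AG_add_subproof W V).

Lemma AG_addP (W V U : AG) : (AG_add W V <= U)%O = (W <= U)%O && (V <= U)%O.
Proof.
have [W0 _ _] := AG_subspace W; have [V0 _ _] := AG_subspace V.
have [_ UD _] := AG_subspace U.
apply/AG_leP/andP => [WVU|[/AG_leP WU /AG_leP VU] _ [x Wx [y Vy <-]]].
  split; apply/AG_leP => x xW; apply: WVU.
    by exists x => //; exists 0 => //; rewrite addr0.
  by exists 0 => //; exists x => //; rewrite add0r.
by apply: UD; auto.
Qed.

(* None when the two subspaces have zero intersection. *)
Definition AG_cap (W V : AG) : option AG := insub (W `&` V).

Lemma AG_capP (W V U : AG) :
  (if AG_cap W V is Some T then (U <= T)%O else false) =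
  (U <= W)%O && (U <= V)%O.
Proof.
have [W0 WD WM] := AG_subspace W; have [V0 VD VM] := AG_subspace V.
have [U0 _ _] := AG_subspace U.
have WV_sub : is_subspace (W `&` V).
  by split=> // [x y [? ?] [? ?]|k x ? [? ?]]; split; auto.
rewrite /AG_cap; case: insubP => [T _ TE|].
  have {}TE : (T : set F) = W `&` V by [].
  apply/AG_leP/andP; rewrite TE.
    by move=> UWV; split; apply/AG_leP => x /UWV[].
  by move=> [/AG_leP UW /AG_leP UV] x Ux; split; auto.
move=> nWV; apply/esym/negP => /andP[/AG_leP UW /AG_leP UV].
move: nWV; rewrite asboolT //= negbK => /eqP WV0.
have /eqP := AG_neq0 U; apply; apply/seteqP; split=> [x Ux|_ -> //].
by rewrite -WV0; split; auto.
Qed.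

End AG.

Section NdAG.
Variables (F : fieldType) (K : divringClosed F).

(* An alias, since MathComp makes a lexicographic product a lattice only when its
   factors are chains; the order is the lexicographic one, see NdAG_leE. *)
Definition NdAG : Type := (nat^d *l AG K)%type.

HB.instance Definition _ := Order.POrder.on NdAG.

Implicit Types u v w : NdAG.

Lemma NdAG_leE u v : (u <= v)%O =
  (v.1 < u.1)%N || ((u.1 == v.1 :> nat) && (u.2 <= v.2)%O).
Proof.
case: u v => [m W] [n V] /=.
have -> : (((m, W) : NdAG) <= (n, V))%O = (n <= m)%N && ((m <= n)%N ==> (W <= V)%O).
  by [].
by case: ltngtP.
Qed.

Definition NdAG_meet u v : NdAG :=
  if (v.1 < u.1)%N then u else
  if (u.1 < v.1)%N then v else
  if AG_cap u.2 v.2 is Some W then (u.1, W) else ((u.1 : nat).+1, AG_full K).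

Definition NdAG_join u v : NdAG :=
  if (v.1 < u.1)%N then v else
  if (u.1 < v.1)%N then u else (u.1, AG_add u.2 v.2).

Fact NdAG_meetP u v w : (u <= NdAG_meet v w)%O = (u <= v)%O && (u <= w)%O.
Proof.
case: u v w => [i U] [j V] [k W]; rewrite /NdAG_meet /=.
case: (ltngtP k j) => [kj|jk|/= ekj].
- rewrite !NdAG_leE /=; case: (ltngtP j i) => [ji|//|ji] /=.
    by rewrite (ltn_trans kj ji).
  by rewrite -ji kj andbT.
- rewrite !NdAG_leE /=; case: (ltngtP k i) => [ki|ik|ki] /=.
  + by rewrite (ltn_trans jk ki).
  + by rewrite andbF.
  + by rewrite -ki jk.
have := AG_capP V W U; rewrite -ekj.
case: AG_cap => [T|] capE; rewrite !NdAG_leE /=.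
  by rewrite capE; case: ltngtP.
case: (ltngtP k i) => [ki|ik|ki] /=.
- rewrite leq_eqVlt eq_sym in ki; case/orP: ki => [/eqP ->|->//].
  by rewrite eqxx orbC; apply/orP; left; apply/AG_leP.
- by rewrite ltnNge (leq_trans (ltnW ik) (leqnSn k)) ltn_eqF // (leq_trans ik).
- by rewrite -ki ltnNge leqnSn ltn_eqF.
Qed.

Fact NdAG_joinP u v w : (NdAG_join u v <= w)%O = (u <= w)%O && (v <= w)%O.
Proof.
case: u v w => [i U] [j V] [k W]; rewrite /NdAG_join /=.
case: (ltngtP j i) => [ji|ij|/= eji]; rewrite !NdAG_leE /=.
- case: (ltngtP k j) => [kj|jk|kj] /=.
  + by rewrite (ltn_trans kj ji).
  + by rewrite andbF.
  + by rewrite kj ji.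
- case: (ltngtP k i) => [ki|//|ki] /=.
    by rewrite (ltn_trans ki ij).
  by rewrite ki ij andbT.
by rewrite -eji AG_addP; case: ltngtP.
Qed.

HB.instance Definition _ :=
  Order.POrder_MeetJoin_isLattice.Build _ NdAG NdAG_meetP NdAG_joinP.

End NdAG.

(* bounded P is the ordinal sum of a point, P and a point. *)
Inductive bounded (P : Type) : Type := Bot | Mid of P | Top.
Arguments Bot {P}.
Arguments Top {P}.

HB.instance Definition _ (P : Type) := gen_eqMixin (bounded P).
HB.instance Definition _ (P : Type) := gen_choiceMixin (bounded P).

Fact bounded_display (d : Order.disp_t) : Order.disp_t. Proof. exact: d. Qed.

Section BoundedPOrder.
Context {d : Order.disp_t} {P : porderType d}.

Definition bounded_le (x y : bounded P) : bool :=
  match x, y with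
  | Bot, _ => true
  | _, Top => true
  | Mid p, Mid q => (p <= q)%O
  | _, _ => false
  end.

Fact bounded_le_refl : reflexive bounded_le.
Proof. by case=> //= p; apply: lexx. Qed.

Fact bounded_le_anti : antisymmetric bounded_le.
Proof. by move=> [|p|] [|q|] //= /le_anti ->. Qed.

Fact bounded_le_trans : transitive bounded_le.
Proof. by move=> [|p|] [|q|] [|r|] //=; apply: le_trans. Qed.

HB.instance Definition _ :=
  Order.Le_isPOrder.Build (bounded_display d) (bounded P)
    bounded_le_refl bounded_le_anti bounded_le_trans.

End BoundedPOrder.

Section BoundedLattice.
Context {d : Order.disp_t} {L : latticeType d}.

Definition bounded_meet (x y : bounded L) : bounded L :=
  match x, y with
  | Top, z | z, Top => z
  | Mid p, Mid q => Mid (p `&` q)%O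
  | _, _ => Bot
  end.

Definition bounded_join (x y : bounded L) : bounded L :=
  match x, y with
  | Bot, z | z, Bot => z
  | Mid p, Mid q => Mid (p `|` q)%O
  | _, _ => Top
  end.

Fact bounded_meetP (x y z : bounded L) :
  (x <= bounded_meet y z)%O = (x <= y)%O && (x <= z)%O.
Proof.
by case: x y z => [|p|] [|q|] [|r|] //=; rewrite /Order.le /= ?andbT ?andbF ?lexI.
Qed.

Fact bounded_joinP (x y z : bounded L) :
  (bounded_join x y <= z)%O = (x <= z)%O && (y <= z)%O.
Proof.
by case: x y z => [|p|] [|q|] [|r|] //=; rewrite /Order.le /= ?andbT ?andbF ?leUx.
Qed.

HB.instance Definition _ :=
  Order.POrder_MeetJoin_isLattice.Build _ (bounded L)
    bounded_meetP bounded_joinP.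

End BoundedLattice.

Section LatticeIsomorphism.
Context {d d' : Order.disp_t}.

Definition lattice_isomorphic (L : latticeType d) (L' : latticeType d') : Prop :=
  exists f : {lmorphism L -> L'}, bijective f.

End LatticeIsomorphism.

(* Main.v *)
(** Let I be a nonzero ideal of R = K + XF[[X]] and let n be the least order of
    a power series f in I. Since XF[[X]] is contained in R, the ideal I contains
    f XF[[X]] = X^(n+1) F[[X]], so I is determined by n and by the K-space of
    the n-th coefficients of its elements. If n = 0, this space is nonzero and
    contained in K, so it is K and I = R; otherwise it can be any nonzero
    K-subspace of F. *)
Require Import Defs.
From HB Require Import structures.
From mathcomp Require Import all_boot all_order all_algebra.
From mathcomp Require Import boolp classical_sets zify.

Set Implicit Arguments.
Unset Strict Implicit.
Unset Printing Implicit Defensive.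

Import Order.TTheory GRing.Theory.
Local Open Scope classical_set_scope.
Local Open Scope ring_scope.

(** Meets and joins are determined by the order, so the inverse of an order isomorphism preserves
    them. The given map goes from [L'] to [L] because ideals are easier to build from the data (n,
    W) than to decode. *)
Lemma lattice_isomorphic_mono (d d' : Order.disp_t) (L : latticeType d)
    (L' : latticeType d') (f : L' -> L) :
    {mono f : x y / (x <= y)%O} -> (forall x, exists y, f y = x) ->
  lattice_isomorphic L L'.
Proof.
move=> f_mono f_surj; pose g x := sval (cid (f_surj x)).
have gK : cancel g f by move=> x; rewrite /g; case: cid.
have fK : cancel f g by move=> y; apply: (inc_inj f_mono); rewrite gK.
have g_mono : {mono g : x y / (x <= y)%O}.
  by move=> x y; rewrite -{2}(gK x) -{2}(gK y) f_mono.
have g_homo : {homo g : x y / (x <= y)%O} by move=> x y; rewrite g_mono.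
have gI : {morph g : x y / (x `&` y)%O}.
  move=> x y; apply/le_anti; rewrite lexI !g_homo ?leIl ?leIr //=.
  by rewrite -(fK (_ `&` _)%O) g_mono lexI -!g_mono fK leIl leIr.
have gU : {morph g : x y / (x `|` y)%O}.
  move=> x y; apply/le_anti; rewrite leUx !g_homo ?leUl ?leUr ?andbT //=.
  by rewrite -(fK (_ `|` _)%O) g_mono leUx -!g_mono fK leUl leUr.
pose mo := Order.isOrderMorphism.Build d L d' L' g g_homo.
pose ml := Order.isMeetLatticeMorphism.Build d L d' L' g gI.
pose jl := Order.isJoinLatticeMorphism.Build d L d' L' g gU.
pose G : {lmorphism L -> L'} := HB.pack g mo ml jl.
by exists G; exists f.
Qed.

Section PowerSeriesDivision.
Variables (F : fieldType) (f h : fps F) (n : nat).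

(** The first [m] coefficients of h / f, for f of order n. Each depends on all earlier ones, which
    are therefore kept in a list. *)
Fixpoint quotient_coefs m : seq F :=
  if m is k.+1 then
    let s := quotient_coefs k in
    rcons s ((h (n + k)%N - \sum_(i < k) s`_i * f (n + k - i)%N) / f n)
  else [::].

Definition fps_quotient : fps F := Fps (fun k => (quotient_coefs k.+1)`_k).

Lemma size_quotient_coefs m : size (quotient_coefs m) = m.
Proof. by elim: m => //= m IHm; rewrite size_rcons IHm. Qed.

Lemma nth_quotient_coefs m i :
  (i < m)%N -> (quotient_coefs m)`_i = fps_quotient i.
Proof.
elim: m => // m IHm; rewrite ltnS leq_eqVlt => /orP[/eqP -> //|im].
by rewrite /= nth_rcons size_quotient_coefs im IHm.
Qed.

Lemma fps_quotientE k : fps_quotient k =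
  (h (n + k)%N - \sum_(i < k) fps_quotient i * f (n + k - i)%N) / f n.
Proof.
rewrite {1}/fps_quotient /= nth_rcons size_quotient_coefs ltnn eqxx.
by congr ((_ - _) / _); apply: eq_bigr => i _; rewrite nth_quotient_coefs.
Qed.

Lemma fps_quotient0 : fps_quotient 0 = h n / f n.
Proof. by rewrite fps_quotientE big_ord0 subr0 addn0. Qed.

Lemma mul_fps_quotient : f n != 0 ->
    (forall i, (i < n)%N -> f i = 0) -> (forall i, (i < n)%N -> h i = 0) ->
  fps_quotient * f = h.
Proof.
move=> fn0 f0 h0; move: fps_quotient fps_quotientE => q qE.
apply: fpsP => m /=; have [mn|/subnKC <-] := ltnP m n.
  by rewrite h0 // big1 // => i _; rewrite f0 ?mulr0 //; lia.
set k := (m - n)%N.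
(* The last n terms of the sum involve coefficients of f below n and vanish; the term of index k is
   the one that [qE] solves for. *)
have -> : (n + k).+1 = (k.+1 + n)%N by rewrite addSn addnC.
rewrite big_split_ord /= [X in _ + X]big1 ?addr0 => [|i _]; last first.
  by rewrite f0 ?mulr0 //; have := ltn_ord i; lia.
by rewrite big_ord_recr /= addnK [q k]qE divfK // addrC subrK.
Qed.

End PowerSeriesDivision.

Section IdealsOfConstFps.
Variables (F : fieldType) (K : divringClosed F).
Local Notation R := (const_fps K).
Implicit Types (x y z : R) (W : AG K) (I : ideal R).

Lemma const_fps_coef0 x : x 0%N \in K.
Proof. by case: x. Qed.

Lemma is_ideal_zero : `[< is_ideal [set (0 : R)] >].
Proof.
apply/asboolP; split=> //= [x y -> ->|a x ->]; first by rewrite addr0.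
by rewrite mulr0.
Qed.

Lemma is_ideal_full : `[< is_ideal [set: R] >].
Proof. by apply/asboolP; split. Qed.

(* The level n of NdAG is made of the ideals of order n + 1, because the only
   ideal of order 0 is R. *)
Definition order_set n (W : set F) : set R :=
  [set x | (forall i, (i <= n)%N -> x i = 0) /\ W (x n.+1)].

(** If x vanishes up to index n, coefficient n + 1 of a x is a_0 x_(n+1) with a_0 in K, so stability
    of W under K suffices. *)
Lemma is_ideal_order n W : `[< is_ideal (order_set n W) >].
Proof.
have [W0 WD WM] := AG_subspace W.
apply/asboolP; split=> [|x y [x0 Wx] [y0 Wy]|a x [x0 Wx]]; split=> //=.
- by move=> i ni; rewrite x0 ?y0 ?addr0.
- exact: WD.
- move=> i ni; rewrite big1 // => j _.
  by rewrite x0 ?mulr0 // (leq_trans (leq_subr _ _)).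
rewrite big_ord_recl big1 ?addr0 => [|j _].
  exact: WM (const_fps_coef0 a) Wx.
by rewrite x0 ?mulr0 //= /bump add1n subSS leq_subr.
Qed.

Definition ideal_of_bounded (u : bounded (NdAG K)) : ideal R :=
  match u with
  | Bot => Ideal is_ideal_zero
  | Mid v => Ideal (is_ideal_order v.1 v.2)
  | Top => Ideal is_ideal_full
  end.

(** The exponent is positive, so a may be any element of F and the monomial still lies in R. *)
Definition shifted_monomial (a : F) (n : nat) : fps F :=
  Fps (fun i => if i == n.+1 then a else 0).

Lemma monomial_in a n : shifted_monomial a n \in const_in K.
Proof. by rewrite inE /= rpred0. Qed.

Definition const_monomial a n : R := ConstFps (monomial_in a n).

Lemma order_set_monomial a n (W : set F) :
  W a -> order_set n W (const_monomial a n).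
Proof.
by move=> Wa; split=> [i ni|] /=; rewrite ?eqxx // ltn_eqF.
Qed.

Lemma AG_neq0P W : exists2 a, (W : set F) a & a != 0.
Proof.
have [W0 _ _] := AG_subspace W; apply: contrapT => nW.
have /eqP[] := AG_neq0 W; apply/seteqP; split=> [a Wa|_ -> //].
by have [//|a0] := eqVneq a 0; case: nW; exists a.
Qed.

Lemma ideal_of_bounded_mono : {mono ideal_of_bounded : u v / (u <= v)%O}.
Proof.
move=> u v; apply/ideal_leP/idP; last first.
  case: u v => [v _|[m W] [|[n V]|]|[|?|]] //=.
    by move=> _ ->; have [] := idealP (ideal_of_bounded v).
  rewrite [(_ <= _)%O]NdAG_leE /= => /orP[nm|/andP[/eqP -> /AG_leP WV]].
    move=> x [x0 _]; split=> [i ni|].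
      by rewrite x0 // (leq_trans ni) // ltnW.
    by rewrite x0 //; case: (AG_subspace V).
  by move=> x [x0 Wx]; split=> //; apply: WV.
(* An inclusion is tested on monomials a X^(m+1) with a in W, and on 1 when the smaller ideal is
   R. *)
case: u v => [|[m W]|] [|[n V]|] //= uv.
- have [a Wa a0] := AG_neq0P W.
  have /(congr1 (fun x : R => x m.+1))/eqP := uv _ (order_set_monomial m Wa).
  by rewrite /= eqxx (negPf a0).
- rewrite [(_ <= _)%O]NdAG_leE /=; have [nm|mn|mn] //= := ltngtP n m.
    have [a Wa a0] := AG_neq0P W.
    have [/(_ m.+1 mn)/eqP] := uv _ (order_set_monomial m Wa).
    by rewrite /= eqxx (negPf a0).
  apply/AG_leP => a Wa.
  have [_] := uv _ (order_set_monomial m Wa).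
  by rewrite /= mn eqxx.
- have /(congr1 (fun x : R => x 0%N))/eqP := uv 1 I.
  by rewrite /= oner_eq0.
- by have [/(_ 0%N isT)/eqP] := uv 1 I; rewrite /= oner_eq0.
Qed.

(** The power series y / x has constant term y_n / x_n, which lies in K, so y is a multiple of x
    within R. *)
Lemma ideal_mem_order I x y n : (I : set R) x -> x n != 0 ->
    (forall i, (i < n)%N -> x i = 0) -> (forall i, (i < n)%N -> y i = 0) ->
  y n / x n \in K -> (I : set R) y.
Proof.
move=> Ix xn0 x0 y0 yxK; have [_ _ IM] := idealP I.
have qK : fps_quotient x y n \in const_in K by rewrite inE fps_quotient0.
suff -> : y = ConstFps qK * x by apply: IM.
by apply: val_inj; rewrite /= mul_fps_quotient.
Qed.

Lemma is_subspace_coef I n :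
    (forall x i, (I : set R) x -> (i <= n)%N -> x i = 0) ->
  is_subspace K [set x n.+1 | x in (I : set R)].
Proof.
move=> I0n; have [I0 ID IM] := idealP I.
split=> [|_ _ [x Ix <-] [y Iy <-]|k _ kK [x Ix <-]]; first by exists 0.
  by exists (x + y); first exact: ID.
(* Scaling by k is multiplication by the constant series k of R. *)
have cK : Fps (fun i => if i == 0%N then k else 0) \in const_in K.
  by rewrite inE.
exists (ConstFps cK * x); first exact: IM.
by rewrite /= big_ord_recl /= big1 ?addr0 // => i _; rewrite mul0r.
Qed.

Lemma ideal_of_bounded_surj I : exists u, ideal_of_bounded u = I.
Proof.
have [I0 ID IM] := idealP I.
have ext (J : ideal R) : (forall x, (J : set R) x <-> (I : set R) x) -> J = I.
  by move=> JI; apply/val_inj/seteqP; split=> x /JI.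
(* The predicate is made boolean so that [ex_minnP] gives the least order of an element of I. *)
have [exn|nex] := pselect (exists n,
    `[< exists2 x, (I : set R) x & x n != 0 >]); last first.
  exists Bot; apply: ext => x; split=> [-> //|Ix].
  apply/val_inj/fpsP => n; apply: contrapT => /eqP xn0; case: nex.
  by exists n; apply/asboolP; exists x.
case: (ex_minnP exn) => -[|n] /asboolP[x Ix xn0] min_n.
  (* At order 0 the quotient y_0 / x_0 is in K for every y in R. *)
  exists Top; apply: ext => y; split=> // _.
  by apply: (ideal_mem_order Ix xn0) => //; rewrite rpred_div ?const_fps_coef0.
have In y i : (I : set R) y -> (i <= n)%N -> y i = 0.
  move=> Iy ni; apply: contraTeq ni => yi0; rewrite -ltnNge.
  by apply: min_n; apply/asboolP; exists y.
have WP : `[< is_subspace K [set y n.+1 | y in (I : set R)] >] &&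
    ([set y n.+1 | y in (I : set R)] != [set 0]).
  rewrite asboolT /=; last exact: is_subspace_coef.
  apply/eqP => W0; have : [set y n.+1 | y in (I : set R)] (x n.+1) by exists x.
  by rewrite W0 => /eqP; apply/negP.
exists (Mid (n, MkAG WP)); apply: ext => y.
split=> [[y0 [z Iz zy]]|Iy]; last first.
  by split=> [i|]; [exact: In|exists y].
(* Here z in I has the same coefficient n + 1 as y, so (y - z) / x has constant term 0. *)
rewrite -(subrK z y); apply: ID => //.
apply: (ideal_mem_order Ix xn0) => [i|i ni|] /=; first exact: In.
  by rewrite y0 // In // subr0.
by rewrite zy subrr mul0r rpred0.
Qed.

End IdealsOfConstFps.

Theorem theorem4p5 (F : fieldType) (K : divringClosed F) :
  lattice_isomorphic (ideal (const_fps K)) (bounded (NdAG K)).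
Proof.
exact: lattice_isomorphic_mono (@ideal_of_bounded_mono F K)
  (@ideal_of_bounded_surj F K).
Qed.
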